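(* Let $F$ be a finitely generated free group. There is an algorithm which, on input a finitely generated subgroup $H\leqslant F$ (given by a finite generating set), an element $u\in F$ and an element $w\in F$, outputs $\mathrm{Ord}_{Hu}(w)$. In particular, the order problem and the torsion problem for $F$ are computable.
   Context: For a group $G$, a subset $S\subseteq G$ and $g\in G$, $\mathrm{Ord}_S(g)=\min\{k\geq 1: g^k\in S\}$ if such $k$ exists and $0$ otherwise. The order problem asks, given a finitely generated $H\leqslant G$ and $g\in G$, to compute $\mathrm{Ord}_H(g)$; the torsion problem asks to decide whether $\mathrm{Ord}_H(g)\neq 0$. *)

(* Defs.v *)
From mathcomp Require Import all_boot.
Set Implicit Arguments.
Unset Strict Implicit.
Unset Printing Implicit Defensive.

(** * Model of computation: mu-recursive (partial recursive) functions on nat.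
    "There is an algorithm" is rendered as "there is a mu-recursive code". *)

Inductive code : Type :=
| CZero : code
| CSucc : code
| CProj : nat -> code
| CComp : code -> list code -> code
| CPrec : code -> code -> code
| CMu   : code -> code.

Inductive eval : code -> seq nat -> nat -> Prop :=
| ev_zero v : eval CZero v 0
| ev_succ x v : eval CSucc (x :: v) x.+1
| ev_proj i v : i < size v -> eval (CProj i) v (nth 0 v i)
| ev_comp f gs v ys y : evals gs v ys -> eval f ys y -> eval (CComp f gs) v y
| ev_prec0 f g v y : eval f v y -> eval (CPrec f g) (0 :: v) y
| ev_precS f g k v r y :
    eval (CPrec f g) (k :: v) r -> eval g (k :: r :: v) y ->
    eval (CPrec f g) (k.+1 :: v) y
| ev_mu f v k :
    eval f (k :: v) 0 ->
    (forall j, j < k -> exists m, eval f (j :: v) m.+1) ->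
    eval (CMu f) v k
with evals : list code -> seq nat -> seq nat -> Prop :=
| evs_nil v : evals nil v [::]
| evs_cons g gs v y ys : eval g v y -> evals gs v ys -> evals (g :: gs) v (y :: ys).

(** * The free group F_n on generators indexed by 'I_n.
    A word is a sequence of letters (i, e): e = false is the generator x_i,
    e = true is its inverse x_i^-1. Elements of F_n are words up to free
    reduction; [reduce] computes the freely reduced normal form. *)

Definition letter (n : nat) := ('I_n * bool)%type.
Definition word (n : nat) := seq (letter n).

Definition inv_letter n (a : letter n) : letter n := (a.1, ~~ a.2).

Definition push n (a : letter n) (s : word n) : word n :=
  if s is b :: s' then (if b == inv_letter a then s' else a :: s) else [:: a].

Definition reduce n (w : word n) : word n := foldr (@push n) [::] w.

Definition weq n (w1 w2 : word n) : Prop := reduce w1 = reduce w2.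

(** Group operations on words: product is concatenation. *)
Definition winv n (w : word n) : word n := rev (map (@inv_letter n) w).
Definition wpow n (w : word n) (k : nat) : word n := flatten (nseq k w).

Definition in_subgroup n (gens : seq (word n)) (x : word n) : Prop :=
  exists s : seq (nat * bool),
    weq x (flatten (map (fun p => if p.2 then winv (nth [::] gens p.1)
                                   else nth [::] gens p.1) s)).

Definition in_coset n (gens : seq (word n)) (u x : word n) : Prop :=
  in_subgroup gens (x ++ winv u).

Definition is_Ord n (S : word n -> Prop) (g : word n) (k : nat) : Prop :=
  (k = 0 /\ forall j, 0 < j -> ~ S (wpow g j)) \/
  (0 < k /\ S (wpow g k) /\ forall j, 0 < j -> j < k -> ~ S (wpow g j)).

(* Main.v *)
(** Membership in [H] is decided by two opposite unbounded searches: for a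
    product of generators equal to [x], and for a finite automaton with
    deterministic and reversible transitions in which every generator of [H] is
    a loop at the base point while the reduced form of [x] is not. The part of
    the Schreier graph of [H] spanned by the generators is such an automaton
    whenever [x] is not in [H], so one of the searches succeeds.

    For the order, conjugate [w] to [v^-1 c v] with [c] cyclically reduced. If
    [w^k] is in [Hu] then [c^k], being reduced, labels a walk between two
    vertices of a finite subgraph of the Schreier graph which never leaves it; if
    [k] exceeds the number of vertices, two of [c, ..., c^k] reach the same
    vertex and the walk can be shortened. So a bounded number of membership
    tests computes the order. *)

Require Import Defs.
From mathcomp Require Import all_boot zify.
From Stdlib Require Import Setoid Morphisms ClassicalEpsilon.
Set Implicit Arguments.
Unset Strict Implicit.
Unset Printing Implicit Defensive.

(** * Computable functions between countable types *)

Definition cconst m := iter m (fun c => CComp CSucc [:: c]) CZero.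
Definition cpred := CPrec CZero (CProj 0).
Definition cis0 := CPrec (cconst 1) CZero.
Definition cadd := CPrec (CProj 0) (CComp CSucc [:: CProj 1]).
(* Computes [y - x] from [x :: y :: _]. *)
Definition csubr := CPrec (CProj 0) (CComp cpred [:: CProj 1]).
Definition cdouble := CPrec CZero (CComp CSucc [:: CComp CSucc [:: CProj 1]]).
Definition codd := CPrec CZero (CComp cis0 [:: CProj 1]).
Definition chalf := CPrec CZero (CComp cadd [:: CComp codd [:: CProj 0]; CProj 1]).
Definition chalves := CPrec (CProj 0) (CComp chalf [:: CProj 1]).
(** [CodeSeq.code] sends [k :: s] to [2 ^ k * (2 * m + 1)], where [m] is the code of [s]. *)
Definition ccons := CPrec (CComp CSucc [:: cdouble]) (CComp cdouble [:: CProj 1]).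
Definition cpair := CComp ccons [:: CProj 0; CComp ccons [:: CProj 1; CZero]].
(** The head is the 2-adic valuation, found as the number of halvings before the first odd value. On
    0, the code of the empty list, the search diverges. *)
Definition chead := CMu (CComp cis0 [:: CComp codd [:: chalves]]).
Definition ctail := CComp chalf [:: CComp chalves [:: chead; CProj 0]].

Lemma eval_comp1 f g v x y : eval g v x -> eval f [:: x] y ->
  eval (CComp f [:: g]) v y.
Proof. by move=> gx fy; apply: ev_comp fy; do ?constructor. Qed.

Lemma eval_comp2 f g h v x y z : eval g v x -> eval h v y ->
  eval f [:: x; y] z -> eval (CComp f [:: g; h]) v z.
Proof. by move=> gx hy fz; apply: ev_comp fz; do ?constructor. Qed.

Lemma eval_proj0 x v : eval (CProj 0) (x :: v) x.
Proof. exact: (@ev_proj 0 (x :: v)). Qed.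

Lemma eval_proj1 x y v : eval (CProj 1) (x :: y :: v) y.
Proof. exact: (@ev_proj 1 (x :: y :: v)). Qed.

Lemma eval_proj2 x y z v : eval (CProj 2) (x :: y :: z :: v) z.
Proof. exact: (@ev_proj 2 (x :: y :: z :: v)). Qed.

Lemma eval_const m v : eval (cconst m) v m.
Proof.
elim: m => [|m IHm]; first exact: ev_zero.
by apply: eval_comp1 IHm _; apply: ev_succ.
Qed.

Lemma eval_pred x v : eval cpred (x :: v) x.-1.
Proof.
elim: x => [|x IHx]; first by apply/ev_prec0/ev_zero.
by apply: ev_precS IHx _; apply: eval_proj0.
Qed.

Lemma eval_is0 x v : eval cis0 (x :: v) (x == 0).
Proof.
elim: x => [|x IHx]; first by apply/ev_prec0/(eval_const 1).
by apply: ev_precS IHx _; apply: ev_zero.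
Qed.

Lemma eval_add x y v : eval cadd (x :: y :: v) (x + y).
Proof.
elim: x => [|x IHx]; first by apply/ev_prec0/eval_proj0.
by apply: ev_precS IHx _; apply: eval_comp1 (eval_proj1 _ _ _) (ev_succ _ _).
Qed.

Lemma eval_subr x y v : eval csubr (x :: y :: v) (y - x).
Proof.
elim: x => [|x IHx]; first by rewrite subn0; apply/ev_prec0/eval_proj0.
rewrite subnS; apply: ev_precS IHx _.
exact: eval_comp1 (eval_proj1 _ _ _) (eval_pred _ _).
Qed.

Lemma eval_double x v : eval cdouble (x :: v) x.*2.
Proof.
elim: x => [|x IHx]; first by apply/ev_prec0/ev_zero.
apply: ev_precS IHx _; apply: eval_comp1 (ev_succ _ _).
exact: eval_comp1 (eval_proj1 _ _ _) (ev_succ _ _).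
Qed.

Lemma eval_odd x v : eval codd (x :: v) (odd x).
Proof.
elim: x => [|x IHx]; first by apply/ev_prec0/ev_zero.
apply: ev_precS IHx _; rewrite oddS -eqb0.
exact: eval_comp1 (eval_proj1 _ _ _) (eval_is0 _ _).
Qed.

Lemma eval_half x v : eval chalf (x :: v) x./2.
Proof.
elim: x => [|x IHx]; first by apply/ev_prec0/ev_zero.
apply: ev_precS IHx _; rewrite -[x.+1./2]/(uphalf x) uphalf_half.
apply: eval_comp2 (eval_add _ _ _); last exact: eval_proj1.
exact: eval_comp1 (eval_proj0 _ _) (eval_odd _ _).
Qed.

Lemma eval_halves k x v : eval chalves (k :: x :: v) (iter k half x).
Proof.
elim: k => [|k IHk]; first by apply/ev_prec0/eval_proj0.
by apply: ev_precS IHk _; apply: eval_comp1 (eval_proj1 _ _ _) (eval_half _ _).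
Qed.

Lemma eval_cons k x v : eval ccons (k :: x :: v) (2 ^ k * x.*2.+1).
Proof.
elim: k => [|k IHk].
  rewrite mul1n; apply/ev_prec0.
  exact: eval_comp1 (eval_double _ _) (ev_succ _ _).
rewrite expnS -mulnA mul2n; apply: ev_precS IHk _.
exact: eval_comp1 (eval_proj1 _ _ _) (eval_double _ _).
Qed.

Lemma eval_pair x y v : eval cpair [:: x, y & v] (CodeSeq.code [:: x; y]).
Proof.
apply: eval_comp2 (eval_cons _ _ _); first exact: eval_proj0.
apply: eval_comp2 (eval_cons _ 0 _); [exact: eval_proj1 | exact: ev_zero].
Qed.

Lemma iter_half_exp j k x : j <= k -> iter j half (2 ^ k * x) = 2 ^ (k - j) * x.
Proof.
elim: j => [|j IHj] ltjk; first by rewrite subn0.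
by rewrite iterS IHj 1?ltnW // -[k - j]prednK ?subn_gt0 // -subnS expnS -mulnA mul2n doubleK.
Qed.

Lemma eval_head k x v : eval chead (2 ^ k * x.*2.+1 :: v) k.
Proof.
have ev j : eval (CComp cis0 [:: CComp codd [:: chalves]])
    [:: j, 2 ^ k * x.*2.+1 & v] (nat_of_bool (odd (iter j half (2 ^ k * x.*2.+1))) == 0).
  by apply: eval_comp1 (eval_is0 _ _); apply: eval_comp1 (eval_halves _ _ _) (eval_odd _ _).
apply: ev_mu => [|j ltjk].
  by have := ev k; rewrite iter_half_exp // subnn mul1n /= odd_double.
exists 0; have := ev j; rewrite iter_half_exp 1?ltnW // oddM oddX.
by rewrite subn_eq0 leqNgt ltjk.
Qed.

Lemma eval_tail k x v : eval ctail (2 ^ k * x.*2.+1 :: v) x.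
Proof.
apply: eval_comp1.
  apply: eval_comp2 (eval_halves _ _ _); [exact: eval_head | exact: eval_proj0].
by rewrite iter_half_exp // subnn mul1n -[X in eval _ _ X]uphalf_double; apply: eval_half.
Qed.

(** Comes from [k + 1 + m <= 2 ^ k * (2 * m + 1)]. It lets the code of a list serve as a loop
    counter and, later, the code of the input as a bound on orders. *)
Lemma sumn_code s : sumn s + size s <= CodeSeq.code s.
Proof. by elim: s => //= k s; have := ltn_expl k (ltnSn 1); nia. Qed.

Lemma size_code s : size s <= CodeSeq.code s.
Proof. exact: leq_trans (leq_addl _ _) (sumn_code s). Qed.

(** Nothing is asked of [c] on numbers that encode no element of [A]; it may diverge there. *)
Definition computable (A B : countType) (f : A -> B) :=
  exists c, forall x, eval c [:: pickle x] (pickle (f x)).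

(** * Closure properties of computable functions *)

Section Computable.
Implicit Types A B C : countType.

Lemma comp_ext A B (f g : A -> B) : f =1 g -> computable f -> computable g.
Proof. by move=> efg [c Hc]; exists c => x; rewrite -efg. Qed.

Lemma comp_id A : computable (fun x : A => x).
Proof. by exists (CProj 0) => x; apply: eval_proj0. Qed.

Lemma comp_const A B (b : B) : computable (fun _ : A => b).
Proof. by exists (cconst (pickle b)) => x; apply: eval_const. Qed.

Lemma comp_comp A B C (g : B -> C) (f : A -> B) :
  computable g -> computable f -> computable (fun x => g (f x)).
Proof.
by move=> [cg Hg] [cf Hf]; exists (CComp cg [:: cf]) => x; apply: eval_comp1 (Hf x) (Hg _).
Qed.

Lemma comp_pair A B C (f : A -> B) (g : A -> C) :
  computable f -> computable g -> computable (fun x => (f x, g x)).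
Proof.
move=> [cf Hf] [cg Hg]; exists (CComp cpair [:: cf; cg]) => x.
exact: eval_comp2 (Hf x) (Hg x) (eval_pair _ _ _).
Qed.

Lemma comp_fst A B C (f : A -> B * C) : computable f -> computable (fun x => (f x).1).
Proof.
move=> [cf Hf]; exists (CComp chead [:: cf]) => x.
exact: eval_comp1 (Hf x) (eval_head _ _ _).
Qed.

Lemma comp_snd A B C (f : A -> B * C) : computable f -> computable (fun x => (f x).2).
Proof.
move=> [cf Hf]; exists (CComp chead [:: CComp ctail [:: cf]]) => x.
exact: eval_comp1 (eval_comp1 (Hf x) (eval_tail _ _ _)) (eval_head _ 0 _).
Qed.

Lemma comp_cons A B (f : A -> B) (g : A -> seq B) :
  computable f -> computable g -> computable (fun x => f x :: g x).
Proof.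
move=> [cf Hf] [cg Hg]; exists (CComp ccons [:: cf; cg]) => x.
exact: eval_comp2 (Hf x) (Hg x) (eval_cons _ _ _).
Qed.

Lemma comp_succ A (f : A -> nat) : computable f -> computable (fun x => (f x).+1).
Proof.
move=> [cf Hf]; exists (CComp CSucc [:: cf]) => x.
exact: eval_comp1 (Hf x) (ev_succ _ _).
Qed.

Lemma comp_pickle A B (f : A -> B) : computable f -> computable (fun x => pickle (f x)).
Proof. by case=> c Hc; exists c. Qed.

Lemma comp_leq A (f g : A -> nat) :
  computable f -> computable g -> computable (fun x => f x <= g x).
Proof.
move=> [cf Hf] [cg Hg]; exists (CComp cis0 [:: CComp csubr [:: cg; cf]]) => x.
exact: eval_comp1 (eval_comp2 (Hg x) (Hf x) (eval_subr _ _ _)) (eval_is0 _ _).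
Qed.

(** A boolean is coded by 0 or 1, so a primitive recursion acts as the branch: base case [g],
    successor case [f]. *)
Lemma comp_if A B (b : A -> bool) (f g : A -> B) :
  computable b -> computable f -> computable g ->
  computable (fun x => if b x then f x else g x).
Proof.
move=> [cb Hb] [cf Hf] [cg Hg].
exists (CComp (CPrec cg (CComp cf [:: CProj 2])) [:: cb; CProj 0]) => x.
apply: eval_comp2 (Hb x) (eval_proj0 _ _) _; rewrite /=.
have Hg0 : eval (CPrec cg (CComp cf [:: CProj 2])) [:: 0; pickle x] (pickle (g x)).
  exact: ev_prec0 (Hg x).
case: (b x) => //; apply: ev_precS Hg0 _.
exact: eval_comp1 (eval_proj2 _ _ _ _) (Hf x).
Qed.

Lemma comp_iter A B (F : A -> B -> B) (n : A -> nat) (i : A -> B) :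
  computable (fun p : A * B => F p.1 p.2) -> computable n -> computable i ->
  computable (fun x => iter (n x) (F x) (i x)).
Proof.
move=> [cF HF] [cn Hn] [ci Hi].
exists (CComp (CPrec ci (CComp cF [:: CComp cpair [:: CProj 2; CProj 1]]))
  [:: cn; CProj 0]) => x.
apply: eval_comp2 (Hn x) (eval_proj0 _ _) _; rewrite -[pickle (n x)]/(n x).
elim: (n x) => [|k IHk]; first exact: ev_prec0 (Hi x).
apply: ev_precS IHk _; apply: eval_comp1 (HF (x, _)).
exact: eval_comp2 (eval_proj2 _ _ _ _) (eval_proj1 _ _ _) (eval_pair _ _ _).
Qed.

(** The empty list has code 0 and any other list a positive code, so a recursion on the code
    branches; its counter and previous value are ignored. The list is passed again as last argument
    and taken apart only in the successor case, where [chead] halts. *)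
Lemma comp_match A B C (l : A -> seq C) (f : A -> B) (g : A -> C -> seq C -> B) :
  computable l -> computable f ->
  computable (fun p : A * C * seq C => g p.1.1 p.1.2 p.2) ->
  computable (fun x => if l x is c :: s then g x c s else f x).
Proof.
move=> [cl Hl] [cf Hf] [cg Hg].
pose arg := CComp cpair [:: CComp cpair [:: CProj 2; CComp chead [:: CProj 3]];
                            CComp ctail [:: CProj 3]].
exists (CComp (CPrec (CComp cf [:: CProj 0]) (CComp cg [:: arg])) [:: cl; CProj 0; cl]) => x.
apply: (@ev_comp _ _ _ [:: pickle (l x); pickle x; pickle (l x)]).
  by do ?constructor; do ?exact: Hl.
have Hf0 d : eval (CComp cf [:: CProj 0]) [:: pickle x; d] (pickle (f x)).
  exact: eval_comp1 (eval_proj0 _ _) (Hf x).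
case: (l x) => [|c s]; first exact: ev_prec0 (Hf0 0).
pose d := pickle (c :: s); rewrite -/d.
have Hg' k r : eval (CComp cg [:: arg]) [:: k; r; pickle x; d] (pickle (g x c s)).
  have Hd := @ev_proj 3 [:: k; r; pickle x; d] isT.
  apply: eval_comp1 (Hg (x, c, s)); apply: eval_comp2 (eval_pair _ _ _).
    exact: eval_comp2 (eval_proj2 _ _ _ _) (eval_comp1 Hd (eval_head _ _ _)) (eval_pair _ _ _).
  exact: eval_comp1 Hd (eval_tail _ _ _).
have: 0 < d by rewrite (leq_trans _ (size_code (map pickle (c :: s)))).
case: {1 2}d => // k _; elim: k => [|k IHk].
  by apply: ev_precS (Hg' _ _); apply: ev_prec0 (Hf0 _).
by apply: ev_precS IHk (Hg' _ _).
Qed.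

Lemma comp_foldl A B C (F : A -> B -> C -> B) (i : A -> B) (l : A -> seq C) :
  computable (fun p : A * B * C => F p.1.1 p.1.2 p.2) ->
  computable i -> computable l ->
  computable (fun x => foldl (F x) (i x) (l x)).
Proof.
move=> HF Hi Hl.
(* The loop on the pair (remaining list, accumulator) runs [pickle (l x)] times,
   at least the length of [l x]; it is stationary once the list is empty. *)
pose step x (st : seq C * B) := if st.1 is c :: s then (s, F x st.2 c) else st.
apply: (@comp_ext _ _ (fun x => (iter (pickle (l x)) (step x) (l x, i x)).2)).
  move=> x; have: size (l x) <= pickle (l x).
    by rewrite -(size_map pickle) size_code.
  elim: (pickle (l x)) {1 4 5}(l x) (i x) => [|k IHk] [|c s] b // szs; rewrite iterSr.
    exact: IHk.
  exact: IHk.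
apply: comp_snd; apply: comp_iter; last by apply: comp_pair.
- apply: comp_match; first by apply/comp_fst/comp_snd/comp_id.
    exact/comp_snd/comp_id.
  apply: comp_pair; first exact/comp_snd/comp_id.
  apply: (comp_comp HF (f := fun p : A * (seq C * B) * C * seq C => (p.1.1.1, p.1.1.2.2, p.1.2))).
  apply: comp_pair; last exact/comp_snd/comp_fst/comp_id.
  by apply: comp_pair; [apply/comp_fst/comp_fst/comp_fst/comp_id|
     apply/comp_snd/comp_snd/comp_fst/comp_fst/comp_id].
- exact: comp_pickle.
Qed.

Lemma comp_eq A B (f g : A -> B) :
  computable f -> computable g -> computable (fun x => f x == g x).
Proof.
move=> Hf Hg; apply: (@comp_ext _ _ (fun x =>
  if pickle (f x) <= pickle (g x) then pickle (g x) <= pickle (f x) else false)).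
  move=> x; rewrite -(inj_eq (pcan_inj pickleK)) eqn_leq.
  by case: (pickle (f x) <= _).
apply: comp_if; last exact: comp_const.
  by apply: comp_leq; apply: comp_pickle.
by apply: comp_leq; apply: comp_pickle.
Qed.

Lemma comp_mu A (P : A -> nat -> bool) :
  computable (fun p : A * nat => P p.1 p.2) -> forall exP : (forall x, exists n, P x n),
  computable (fun x => ex_minn (exP x)).
Proof.
move=> [c Hc] exP.
(* [CMu] looks for a zero, hence the negation by [cis0]; it puts the search variable first, hence
   the swapped projections. *)
exists (CMu (CComp cis0 [:: CComp c [:: CComp cpair [:: CProj 1; CProj 0]]])) => x.
have ev k : eval (CComp cis0 [:: CComp c [:: CComp cpair [:: CProj 1; CProj 0]]])
    [:: k; pickle x] (nat_of_bool (P x k) == 0).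
  apply: eval_comp1 (eval_is0 _ _); apply: eval_comp1 (Hc (x, k)).
  exact: eval_comp2 (eval_proj1 _ _ _) (eval_proj0 _ _) (eval_pair _ _ _).
case: ex_minnP => m Pm minm; apply: ev_mu => [|j ltjm].
  by have := ev m; rewrite Pm.
by exists 0; have := ev j; case Pj: (P x j) => //; rewrite ltnNge minm in ltjm.
Qed.

Lemma comp_neg A (b : A -> bool) : computable b -> computable (fun x => ~~ b x).
Proof. by move=> Hb; apply: comp_if => //; apply: comp_const. Qed.

Lemma comp_and A (b c : A -> bool) :
  computable b -> computable c -> computable (fun x => b x && c x).
Proof. by move=> Hb Hc; apply: comp_if => //; apply: comp_const. Qed.

Lemma comp_or A (b c : A -> bool) :
  computable b -> computable c -> computable (fun x => b x || c x).
Proof. by move=> Hb Hc; apply: comp_if => //; apply: comp_const. Qed.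

Lemma comp_implb A (b c : A -> bool) :
  computable b -> computable c -> computable (fun x => b x ==> c x).
Proof. by move=> Hb Hc; apply: comp_if => //; apply: comp_const. Qed.

Lemma comp_rev A B (l : A -> seq B) : computable l -> computable (fun x => rev (l x)).
Proof.
move=> Hl; apply: (@comp_ext _ _ (fun x => foldl (fun s b => b :: s) [::] (l x))).
  by move=> x; rewrite /rev; elim: (l x) [::] => /=.
apply: comp_foldl => //; last exact: comp_const.
by apply: comp_cons; [exact/comp_snd/comp_id | exact/comp_snd/comp_fst/comp_id].
Qed.

Lemma comp_foldr A B C (F : A -> C -> B -> B) (i : A -> B) (l : A -> seq C) :
  computable (fun p : A * C * B => F p.1.1 p.1.2 p.2) ->
  computable i -> computable l ->
  computable (fun x => foldr (F x) (i x) (l x)).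
Proof.
move=> HF Hi Hl.
apply: (@comp_ext _ _ (fun x => foldl (fun b c => F x c b) (i x) (rev (l x)))).
  by move=> x; rewrite foldl_rev.
apply: comp_foldl => //; last exact: comp_rev.
apply: (comp_comp HF (f := fun p : A * B * C => (p.1.1, p.2, p.1.2))).
apply: comp_pair; last exact/comp_snd/comp_fst/comp_id.
by apply: comp_pair; [exact/comp_fst/comp_fst/comp_id | exact/comp_snd/comp_id].
Qed.

Lemma comp_cat A B (s t : A -> seq B) :
  computable s -> computable t -> computable (fun x => s x ++ t x).
Proof.
move=> Hs Ht; apply: (@comp_ext _ _ (fun x => foldr cons (t x) (s x))).
  by move=> x; elim: (s x) => //= b l ->.
apply: comp_foldr => //.
by apply: comp_cons; [exact/comp_snd/comp_fst/comp_id | exact/comp_snd/comp_id].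
Qed.

Lemma comp_flatten A B (l : A -> seq (seq B)) :
  computable l -> computable (fun x => flatten (l x)).
Proof.
move=> Hl; apply: comp_foldr => //; last exact: comp_const.
by apply: comp_cat; [exact/comp_snd/comp_fst/comp_id | exact/comp_snd/comp_id].
Qed.

Lemma comp_map A B C (F : A -> B -> C) (l : A -> seq B) :
  computable (fun p : A * B => F p.1 p.2) -> computable l ->
  computable (fun x => map (F x) (l x)).
Proof.
move=> HF Hl; apply: (@comp_ext _ _ (fun x => foldr (fun b s => F x b :: s) [::] (l x))).
  by move=> x; elim: (l x) => //= b s ->.
apply: comp_foldr => //; last exact: comp_const.
by apply: comp_cons; [apply: (comp_comp HF); exact/comp_fst/comp_id | exact/comp_snd/comp_id].
Qed.

Lemma comp_filter A B (P : A -> B -> bool) (l : A -> seq B) :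
  computable (fun p : A * B => P p.1 p.2) -> computable l ->
  computable (fun x => filter (P x) (l x)).
Proof.
move=> HP Hl; apply: (@comp_ext _ _ (fun x =>
   foldr (fun b s => if P x b then b :: s else s) [::] (l x))).
  by move=> x; elim: (l x) => //= b s ->.
apply: comp_foldr => //; last exact: comp_const.
apply: comp_if; last exact/comp_snd/comp_id.
  by apply: (comp_comp HP); exact/comp_fst/comp_id.
by apply: comp_cons; [exact/comp_snd/comp_fst/comp_id | exact/comp_snd/comp_id].
Qed.

Lemma comp_has A B (P : A -> B -> bool) (l : A -> seq B) :
  computable (fun p : A * B => P p.1 p.2) -> computable l ->
  computable (fun x => has (P x) (l x)).
Proof.
move=> HP Hl; apply: (@comp_ext _ _ (fun x => foldr (fun b r => P x b || r) false (l x))).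
  by move=> x; elim: (l x) => //= b s ->.
apply: comp_foldr => //; last exact: comp_const.
apply: comp_or; last exact/comp_snd/comp_id.
by apply: (comp_comp HP); exact/comp_fst/comp_id.
Qed.

Lemma comp_all A B (P : A -> B -> bool) (l : A -> seq B) :
  computable (fun p : A * B => P p.1 p.2) -> computable l ->
  computable (fun x => all (P x) (l x)).
Proof.
move=> HP Hl; apply: (@comp_ext _ _ (fun x => ~~ has (fun b => ~~ P x b) (l x))).
  by move=> x; rewrite -all_predC; apply: eq_all => b /=; rewrite negbK.
by apply: comp_neg; apply: comp_has => //; apply: comp_neg.
Qed.

Lemma comp_mem A (B : countType) (y : A -> B) (l : A -> seq B) :
  computable y -> computable l -> computable (fun x => y x \in l x).
Proof.
move=> Hy Hl; apply: (@comp_ext _ _ (fun x => has (fun b => b == y x) (l x))).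
  by move=> x; rewrite has_pred1.
apply: comp_has => //; apply: comp_eq; first exact/comp_snd/comp_id.
exact: (comp_comp Hy (comp_fst (comp_id _))).
Qed.

Lemma comp_nth A B (x0 : B) (s : A -> seq B) (i : A -> nat) :
  computable s -> computable i -> computable (fun x => nth x0 (s x) (i x)).
Proof.
move=> Hs Hi; apply: (@comp_ext _ _ (fun x =>
   if iter (i x) (fun t => if t is _ :: t' then t' else t) (s x) is b :: _ then b else x0)).
  move=> x; elim: (i x) (s x) => [|k IHk] [|b t] //.
    by rewrite iter_fix.
  by rewrite iterSr IHk.
apply: comp_match; last exact/comp_snd/comp_fst/comp_id; last exact: comp_const.
apply: comp_iter => //; apply: comp_match; last exact/comp_snd/comp_id.
  exact/comp_snd/comp_id.
exact/comp_snd/comp_id.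
Qed.

End Computable.

(** Follows the syntax of the function: hypotheses are tried first, then the closure lemma for the
    head symbol of the body. *)
Ltac comp_step := match goal with
  | H : computable ?f |- computable ?f => exact: H
  | H : computable ?f |- computable (fun x => ?f (@?g x)) => apply: (@comp_comp _ _ _ f g H)
  | _ => lazymatch goal with
  | |- computable fst => exact: comp_fst (comp_id _)
  | |- computable pickle => exact: comp_pickle (comp_id _)
  | |- computable snd => exact: comp_snd (comp_id _)
  | |- computable (fun _ => ?b) => exact: comp_const
  | |- computable (fun x => x) => exact: comp_id
  | |- computable (fun _ => (_, _)) => apply: comp_pair
  | |- computable (fun _ => _.1) => apply: comp_fst
  | |- computable (fun _ => _.2) => apply: comp_snd
  | |- computable (fun _ => _ :: _) => apply: comp_cons
  | |- computable (fun _ => _.+1) => apply: comp_succ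
  | |- computable (fun _ => pickle _) => apply: comp_pickle
  | |- computable (fun _ => leq _ _) => apply: comp_leq
  | |- computable (fun _ => eq_op _ _) => apply: comp_eq
  | |- computable (fun _ => negb _) => apply: comp_neg
  | |- computable (fun _ => andb _ _) => apply: comp_and
  | |- computable (fun _ => orb _ _) => apply: comp_or
  | |- computable (fun _ => implb _ _) => apply: comp_implb
  | |- computable (fun _ => if _ then _ else _) => apply: comp_if
  | |- computable (fun _ => rev _) => apply: comp_rev
  | |- computable (fun _ => cat _ _) => apply: comp_cat
  | |- computable (fun _ => flatten _) => apply: comp_flatten
  | |- computable (fun _ => map _ _) => apply: comp_map
  | |- computable (map ?F) => apply: (@comp_map _ _ _ (fun _ => F))
  | |- computable (fun _ => filter _ _) => apply: comp_filter
  | |- computable (fun _ => all _ _) => apply: comp_all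
  | |- computable (fun _ => has _ _) => apply: comp_has
  | |- computable (fun _ => foldr _ _ _) => apply: comp_foldr
  | |- computable (fun _ => foldl _ _ _) => apply: comp_foldl
  | |- computable (fun _ => iter _ _ _) => apply: comp_iter
  | |- computable (fun _ => nth _ _ _) => apply: comp_nth
  | |- computable (fun _ => _ \in _) => apply: comp_mem
  end end; cbv beta.
Ltac comp := repeat comp_step.

(** * Computability of the operations on words *)

Section WordComp.
Variable n : nat.
Implicit Types A : countType.

Lemma comp_inv_letter A (a : A -> letter n) :
  computable a -> computable (fun x => inv_letter (a x)).
Proof. by move=> Ha; rewrite /inv_letter; comp. Qed.

Lemma comp_push A (a : A -> letter n) (s : A -> word n) :
  computable a -> computable s -> computable (fun x => push (a x) (s x)).
Proof.
by move=> Ha Hs; rewrite /push; apply: comp_match => //; comp; apply: comp_inv_letter; comp.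
Qed.

Lemma comp_reduce A (w : A -> word n) :
  computable w -> computable (fun x => reduce (w x)).
Proof. by move=> Hw; rewrite /reduce; comp; apply: comp_push; comp. Qed.

Lemma comp_winv A (w : A -> word n) :
  computable w -> computable (fun x => winv (w x)).
Proof. by move=> Hw; rewrite /winv; comp; apply: comp_inv_letter; comp. Qed.

Lemma comp_wpow A (w : A -> word n) (k : A -> nat) :
  computable w -> computable k -> computable (fun x => wpow (w x) (k x)).
Proof.
move=> Hw Hk; apply: (@comp_ext _ _ (fun x => iter (k x) (fun t => w x ++ t) [::])).
  by move=> x; rewrite /wpow; elim: (k x) => //= j ->.
by comp.
Qed.
End WordComp.

(** * Words and free reduction *)

Section FreeGroup.
Variable n : nat.
Implicit Types (a b : letter n) (x y z w u v p q : word n).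

Definition noncancel a b := b != inv_letter a.
Definition reduced x := sorted noncancel x.

Lemma inv_letterK : involutive (@inv_letter n).
Proof. by case=> i e; rewrite /inv_letter negbK. Qed.

Lemma push_reduced a x : reduced x -> reduced (push a x).
Proof.
case: x => [|b x] //= red_x; case: eqP => [_|/eqP ab]; first exact: path_sorted red_x.
by rewrite /= [noncancel a b]ab.
Qed.

(** If the inner push cancels a leading [a] of [x], the next letter is not [inv_letter a] because
    [x] is reduced, so the outer push restores [a]. *)
Lemma pushK a x : reduced x -> push a (push (inv_letter a) x) = x.
Proof.
case: x => [|b x] /=; first by rewrite eqxx.
rewrite inv_letterK; case: eqP => [->|_] /=; last by rewrite eqxx.
by case: x => [|c x] //=; rewrite /noncancel => /andP[/negPf->].
Qed.

Lemma foldr_push_reduced x y : reduced y -> reduced (foldr (@push n) y x).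
Proof. by move=> red_y; elim: x => //= a x; apply: push_reduced. Qed.

Lemma reduce_reduced x : reduced (reduce x).
Proof. exact: foldr_push_reduced. Qed.

Lemma reduce_id x : reduced x -> reduce x = x.
Proof.
elim: x => //= a x IHx red_ax; rewrite -/(reduce x) IHx; last exact: path_sorted red_ax.
by case: x red_ax {IHx} => //= b x /andP[/negPf->].
Qed.

(** Each cancellation inside [x] pushes a letter right after its inverse, which [pushK] undoes. This
    is what makes concatenation compatible with [weq]. *)
Lemma foldr_push_reduce x y : reduced y -> foldr (@push n) y (reduce x) = foldr (@push n) y x.
Proof.
move=> red_y; elim: x => //= a x; rewrite -/(reduce x) => <-.
case: (reduce x) => [|b x'] //=; case: eqP => [->|] //=.
by rewrite pushK // foldr_push_reduced.
Qed.

Lemma reduce_cat x y : reduce (x ++ y) = foldr (@push n) (reduce y) x.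
Proof. exact: foldr_cat. Qed.

Lemma reduceK x : weq (reduce x) x.
Proof. exact/reduce_id/reduce_reduced. Qed.

Global Instance weq_equiv : Equivalence (@weq n).
Proof. by split=> [x|x y|x y z]; rewrite /weq => // -> . Qed.

Global Instance cat_weq : Proper (@weq n ==> @weq n ==> @weq n) cat.
Proof.
move=> x x' ex y y' ey; rewrite /weq !reduce_cat ey -(foldr_push_reduce x) ?reduce_reduced //.
by rewrite ex foldr_push_reduce ?reduce_reduced.
Qed.

Lemma winv_cat x y : winv (x ++ y) = winv y ++ winv x.
Proof. by rewrite /winv map_cat rev_cat. Qed.

Lemma winv_cons a x : winv (a :: x) = winv x ++ [:: inv_letter a].
Proof. by rewrite /winv /= rev_cons -cats1. Qed.

Lemma winvK : involutive (@winv n).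
Proof.
move=> x; rewrite /winv map_rev revK -map_comp map_id_in // => a _ /=.
exact: inv_letterK.
Qed.

Lemma weq_letterV a x : weq ([:: a, inv_letter a & x]) x.
Proof. by rewrite /weq /= pushK // reduce_reduced. Qed.

Lemma weq_rcons_letterV a x : weq ((x ++ [:: a]) ++ [:: inv_letter a]) x.
Proof. by rewrite /weq -catA reduce_cat /= eqxx. Qed.

Lemma cat_winv x : weq (x ++ winv x) [::].
Proof.
elim: x => //= a x IHx; rewrite winv_cons -cat_rcons -cats1 -cat1s catA.
rewrite -!catA (catA x) IHx /=; exact: weq_letterV.
Qed.

Lemma winv_catl x : weq (winv x ++ x) [::].
Proof. by rewrite -{2}[x]winvK cat_winv. Qed.

Lemma cat_winvK x y : weq (x ++ winv x ++ y) y.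
Proof. by rewrite catA cat_winv. Qed.

Lemma cat_winvKl x y : weq (winv x ++ x ++ y) y.
Proof. by rewrite catA winv_catl. Qed.

Global Instance winv_weq : Proper (@weq n ==> @weq n) (@winv n).
Proof.
move=> x y exy; rewrite -[winv x](cats0) -(cat_winv y) -{1}exy catA.
by rewrite -catA cat_winvKl.
Qed.

Global Instance wpow_weq : Proper (@weq n ==> eq ==> @weq n) (@wpow n).
Proof. by move=> x y exy k _ <-; elim: k => //= k IHk; rewrite /wpow /= -!/(wpow _ _) IHk exy. Qed.

Lemma wpowD x j k : wpow x (j + k) = wpow x j ++ wpow x k.
Proof. by rewrite /wpow nseqD flatten_cat. Qed.

Lemma wpow_conj v x k : weq (wpow (winv v ++ x ++ v) k) (winv v ++ wpow x k ++ v).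
Proof.
elim: k => [|k IHk]; first by rewrite /= winv_catl.
rewrite -[k.+1]/(1 + k) !wpowD IHk {1 3}/wpow /= !cats0 -!catA.
by rewrite (catA v) cat_winv.
Qed.

Lemma size_reduce x : size (reduce x) <= size x.
Proof.
elim: x => //= a x IHx; rewrite -/(reduce x); case: (reduce x) IHx => //= b s szs.
by case: ifP => //= _; rewrite ltnW ?ltnS // ltnW.
Qed.

(** The hypothesis is cyclic reducedness: starting the path at the last letter also forbids
    cancellation where two copies meet. *)
Lemma wpow_reduced a x k : path noncancel (last a x) (a :: x) -> reduced (wpow (a :: x) k).
Proof.
rewrite /= => /andP[lasta patha].
have: path noncancel (last a x) (wpow (a :: x) k).
  elim: k => //= k IHk; rewrite -/(wpow _ k) lasta cat_path patha /=; exact: IHk.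
exact: path_sorted.
Qed.

(** Induction on length: as long as the first and last letters of the reduced form cancel, both are
    stripped and moved into the conjugator. *)
Lemma cyclic_reduction x :
  exists v c, [/\ weq x (winv v ++ c ++ v), size v <= size x & forall k, reduced (wpow c k)].
Proof.
have [m] := ubnP (size x); elim: m x => // m IHm x szx.
have [r red_r [xr szr]] : exists2 r, reduced r & weq x r /\ size r <= size x.
  exists (reduce x); first exact: reduce_reduced.
  by split; [symmetry; apply: reduceK | apply: size_reduce].
case: r => [|a r] in red_r xr szr.
  exists [::], [::]; split=> //; rewrite /wpow; elim=> //=.
case: (boolP (noncancel (last a r) a)) => [lasta|].
  exists [::], (a :: r); split=> [||k]; rewrite ?cats0 //.
  by apply: wpow_reduced; rewrite /= lasta.
rewrite negbK => /eqP ea.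
(* A one-letter word is excluded here, since no letter is its own inverse. *)
case/lastP: r => [|r b] in red_r xr szr ea *.
  by case: a {xr red_r szr} ea => i [].
rewrite last_rcons in ea; have [|v [c [rvc szv redc]]] := IHm r.
  by rewrite /= size_rcons in szr; apply: leq_trans (ltnW szr) _; rewrite -ltnS.
exists (v ++ [:: b]), c; split=> //.
  by rewrite xr winv_cat -cats1 -cat1s rvc ea -!catA.
by rewrite size_cat addn1 (leq_trans _ szr) // /= size_rcons; apply: leqW.
Qed.
End FreeGroup.

(** * Subgroups, automata and the Schreier graph *)

Section Subgroup.
Variables (n : nat) (gens : seq (word n)).
Implicit Types (a : letter n) (x y z w u v p q g h : word n).
Local Notation inH := (in_subgroup gens).

Lemma in_subgroup_weq x y : weq x y -> inH x -> inH y.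
Proof. by move=> exy [s xs]; exists s; rewrite -exy. Qed.

Lemma in_subgroup1 : inH [::].
Proof. by exists [::]. Qed.

Lemma in_subgroupM x y : inH x -> inH y -> inH (x ++ y).
Proof. by move=> [s xs] [t yt]; exists (s ++ t); rewrite map_cat flatten_cat xs yt. Qed.

Lemma in_subgroup_gen g : g \in gens -> inH g.
Proof. by exists [:: (index g gens, false)]; rewrite /= nth_index // cats0. Qed.

Lemma in_subgroupV x : inH x -> inH (winv x).
Proof.
case=> s xs; exists (rev [seq (i.1, ~~ i.2) | i <- s]); rewrite xs {x xs}.
elim: s => //= -[i e] s IHs; rewrite winv_cat rev_cons -cats1 map_cat flatten_cat /= cats0 IHs.
by case: e; rewrite /= ?winvK.
Qed.

(** Induction on the number of factors. An index out of range reads as the empty word, the default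
    of [nth], and contributes nothing. *)
Lemma in_subgroup_ind (P : word n -> Prop) :
  (forall x y, weq x y -> P x -> P y) -> P [::] ->
  (forall g x, g \in gens -> P x -> P (g ++ x)) ->
  (forall g x, g \in gens -> P x -> P (winv g ++ x)) ->
  forall x, inH x -> P x.
Proof.
move=> Pweq P1 Pg PV x [s xs]; apply: Pweq (_ : weq (flatten _) x) _; first by symmetry; apply: xs.
elim: s {xs} => //= -[i e] s IHs /=.
have [lti|lei] := ltnP i (size gens); last by rewrite !nth_default //; case: e.
by case: e; [apply: PV | apply: Pg]; rewrite ?mem_nth.
Qed.

(** Equality of the right cosets [Hx] and [Hy]. These cosets are the vertices of the Schreier graph,
    whose edges are right multiplications by a letter. *)
Definition same_coset x y := inH (x ++ winv y).

Global Instance same_coset_equiv : Equivalence same_coset.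
Proof.
split=> [x|x y Hxy|x y z Hxy Hyz].
- by apply: in_subgroup_weq in_subgroup1; rewrite cat_winv.
- by apply: in_subgroup_weq (in_subgroupV Hxy); rewrite winv_cat winvK.
by apply: in_subgroup_weq (in_subgroupM Hxy Hyz); rewrite -catA cat_winvKl.
Qed.

Lemma weq_same_coset x y : weq x y -> same_coset x y.
Proof. by move=> exy; apply: in_subgroup_weq in_subgroup1; rewrite exy cat_winv. Qed.

Lemma same_coset_cat z x y : same_coset x y -> same_coset (x ++ z) (y ++ z).
Proof.
by apply: in_subgroup_weq; rewrite winv_cat -catA cat_winvK.
Qed.

Lemma same_coset1 x : same_coset [::] x <-> inH x.
Proof.
split=> Hx; last exact: in_subgroupV.
by rewrite -[x]winvK; apply: in_subgroupV.
Qed.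

(** Listing the inverses after the generators removes the signs, so that a plain list of numbers
    certifies membership. *)
Lemma in_subgroup_nth x :
  inH x <-> exists s, weq x (flatten (map (nth [::] (gens ++ map (@winv n) gens)) s)).
Proof.
split; last first.
  case=> s xs; apply: in_subgroup_weq (_ : weq (flatten _) x) _; first by symmetry; apply: xs.
  elim: s {xs} => [|i s IHs] /=; first exact: in_subgroup1.
  apply: in_subgroupM IHs; set gens' := _ ++ _.
  have [lti|lei] := ltnP i (size gens'); last by rewrite nth_default //; apply: in_subgroup1.
  have := mem_nth [::] lti; rewrite mem_cat => /orP[/in_subgroup_gen//|/mapP[g gG ->]].
  exact/in_subgroupV/in_subgroup_gen.
pose gens' := gens ++ map (@winv n) gens.
apply: (@in_subgroup_ind (fun x => exists s, weq x (flatten (map (nth [::] gens') s))))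
  => [y z eyz [s ys]||g y gG [s ys]|g y gG [s ys]].
- by exists s; rewrite -eyz.
- by exists [::].
- exists (index g (gens ++ map (@winv n) gens) :: s).
  by rewrite /= nth_index ?ys // mem_cat gG.
exists (index (winv g) (gens ++ map (@winv n) gens) :: s).
by rewrite /= nth_index ?ys // mem_cat map_f ?orbT.
Qed.

End Subgroup.

(** * Finite automata with edges labelled by letters *)

Section Automaton.
Variable n : nat.
Implicit Types (a : letter n) (x y z g : word n) (S : seq nat) (E : seq (nat * letter n * nat)).

(** Runs are followed on sets of states, so acceptance is a boolean computation for any list of
    edges, deterministic or not. *)
Definition successors E S a := [seq e.2 | e <- E & (e.1.1 \in S) && (e.1.2 == a)].
Definition symm E := E ++ [seq (e.2, inv_letter e.1.2, e.1.1) | e <- E].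
(** On [symm E] this also makes every letter act injectively, since edges can be reversed: it is the
    condition for a folded graph in the sense of Stallings. *)
Definition det E := all (fun e => all (fun e' => (e.1 == e'.1) ==> (e.2 == e'.2)) E) E.
Definition accepts E z := 0 \in foldl (successors E) [:: 0] z.

Fixpoint traces E s z t :=
  if z is a :: z' then exists2 r, (s, a, r) \in E & traces E r z' t else s = t.

Lemma mem_successors E S a t :
  reflect (exists2 s, s \in S & (s, a, t) \in E) (t \in successors E S a).
Proof.
apply: (iffP mapP) => [[[[s b] r]]|[s Ss Et]].
  by rewrite mem_filter /= => /andP[/andP[Ss /eqP->] Er] ->; exists s.
by exists (s, a, t) => //; rewrite mem_filter /= Ss eqxx.
Qed.

Lemma foldl_successors E S z t :
  t \in foldl (successors E) S z <-> exists2 s, s \in S & traces E s z t.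
Proof.
elim: z S => [|a z IHz] S /=; first by split=> [St|[s Ss <-]] //; exists t.
rewrite IHz; split=> [[r /mem_successors[s Ss Er] rt]|[s Ss [r Er rt]]].
  by exists s => //; exists r.
by exists r => //; apply/mem_successors; exists s.
Qed.

Lemma acceptsP E z : accepts E z <-> traces E 0 z 0.
Proof.
rewrite /accepts foldl_successors; split=> [[s]|]; last by exists 0; rewrite ?mem_head.
by rewrite inE => /eqP->.
Qed.

Lemma traces_cat E s r t y z : traces E s y r -> traces E r z t -> traces E s (y ++ z) t.
Proof. by elim: y s => [|a y IHy] s /= => [->//|[m Em /IHy mt] /mt]; exists m. Qed.

Lemma symm_inv E s a t : (s, a, t) \in symm E -> (t, inv_letter a, s) \in symm E.
Proof.
rewrite !mem_cat => /orP[Ee|/mapP[[[r b] m] /= Ee [-> -> ->]]].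
  by apply/orP; right; apply/mapP; exists (s, a, t).
by rewrite inv_letterK Ee.
Qed.

Lemma traces_inv E s t z : traces (symm E) s z t -> traces (symm E) t (winv z) s.
Proof.
elim: z s => [|a z IHz] s /=; first by move->.
case=> r Er /IHz rt; rewrite winv_cons; apply: traces_cat rt _.
by exists s => //; apply: symm_inv.
Qed.

Lemma detP E s a t t' : det E -> (s, a, t) \in E -> (s, a, t') \in E -> t = t'.
Proof. by move=> /allP detE /detE/allP dett /dett /=; rewrite eqxx => /eqP. Qed.

(** A cancelling pair follows an edge and then its inverse label; determinism forces the return to
    the starting state. *)
Lemma traces_reduce E s t z : det (symm E) ->
  traces (symm E) s z t -> traces (symm E) s (reduce z) t.
Proof.
move=> detE; elim: z s => //= a z IHz s [r Er /IHz]; rewrite -/(reduce z).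
case: (reduce z) => [|b z'] /=; first by exists r.
case=> m Em mt; case: eqP Em => [->|_] Em; last by exists r => //; exists m.
by rewrite (detP detE (symm_inv Er) Em).
Qed.

(** Soundness of certificates of non-membership. Loops at 0 are closed under product and inverse,
    but a word equal in the group to a loop may be untraceable; reduced forms avoid this. *)
Lemma accepts_subgroup E gens x : det (symm E) -> all (accepts (symm E)) gens ->
  in_subgroup gens x -> accepts (symm E) (reduce x).
Proof.
move=> detE /allP accE Hx; apply/acceptsP.
apply: (@in_subgroup_ind _ gens (fun x => traces (symm E) 0 (reduce x) 0)) Hx => //.
- by move=> y z ->.
- move=> g y /accE/acceptsP g0 y0; have -> : weq (g ++ y) (g ++ reduce y) by rewrite reduceK.
  by apply: traces_reduce => //; apply: traces_cat g0 y0.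
move=> g y /accE/acceptsP/traces_inv g0 y0.
have -> : weq (winv g ++ y) (winv g ++ reduce y) by rewrite reduceK.
by apply: traces_reduce => //; apply: traces_cat g0 y0.
Qed.

End Automaton.

(** * The part of the Schreier graph spanned by the generators *)

Section Schreier.
Variables (n : nat) (gens : seq (word n)).
Implicit Types (a : letter n) (x y z g : word n) (E : seq (nat * letter n * nat)).

(** A coset is numbered by the least code of its words; [H] gets 0, the code of the empty word. The
    choice is classical and serves only in existence proofs. *)
Lemma coset_numbering : exists f : word n -> nat,
  f [::] = 0 /\ forall x y, f x = f y <-> same_coset gens x y.
Proof.
pose P x m : bool :=
  if excluded_middle_informative (exists2 y, same_coset gens x y & pickle y = m)
  then true else false.
have PP x m : P x m <-> exists2 y, same_coset gens x y & pickle y = m.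
  by rewrite /P; case: excluded_middle_informative => H; split.
have exP x : exists m, P x m by exists (pickle x); apply/PP; exists x => //; reflexivity.
exists (fun x => ex_minn (exP x)); split=> [|x y].
  case: ex_minnP => m _ minm; apply/eqP; rewrite -leqn0; apply: minm.
  by apply/PP; exists [::] => //; reflexivity.
split=> [|exy].
  case: ex_minnP => m /PP[x' xx' <-] _; case: ex_minnP => m' /PP[y' yy' <-] _.
  by move/(pcan_inj pickleK) => exy; rewrite xx' exy; symmetry.
apply: eq_ex_minn => m; apply/idP/idP => /PP[z Hz <-]; apply/PP; exists z => //.
  by rewrite -exy.
by rewrite exy.
Qed.

Fixpoint walk_edges (f : word n -> nat) x z : seq (nat * letter n * nat) :=
  if z is a :: z' then (f x, a, f (x ++ [:: a])) :: walk_edges f (x ++ [:: a]) z' else [::].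

Lemma nonmember_automaton x : ~ in_subgroup gens x ->
  exists E, [/\ det (symm E), all (accepts (symm E)) gens & ~~ accepts (symm E) (reduce x)].
Proof.
move=> Hx; have [f [f1 fP]] := coset_numbering.
pose E := flatten (map (walk_edges f [::]) gens); exists E.
have fcat y y' z : f y = f y' -> f (y ++ z) = f (y' ++ z).
  by move/fP/(same_coset_cat z)/fP.
(* Each edge is an edge of the Schreier graph, read from any representative [y] of its source; so
   source and label determine the target. *)
have Ef s a t : (s, a, t) \in symm E -> forall y, s = f y -> t = f (y ++ [:: a]).
  suff Ef' b r m : (r, b, m) \in E -> exists y, r = f y /\ m = f (y ++ [:: b]).
    rewrite mem_cat => /orP[/Ef'[y [-> ->]] y' /fcat //|/mapP[[[r b] m] /Ef'[y [-> ->]]]].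
    case=> -> -> -> y' eyy' /=; rewrite -(fcat _ _ _ eyy'); apply/fP/weq_same_coset.
    by symmetry; apply: weq_rcons_letterV.
  case/flattenP=> es /mapP[g _ ->]; elim: g {1}[::] => //= c g IHg y.
  by rewrite inE => /orP[/eqP[-> -> ->]|/IHg //]; exists y.
have tracesf z : forall s t, traces (symm E) s z t -> forall y, s = f y -> t = f (y ++ z).
  elim: z => [s t <- y ->|a z IHz s t [r Er rt] y sy]; first by rewrite cats0.
  by rewrite (IHz _ _ rt _ (Ef _ _ _ Er _ sy)) -catA.
split.
- apply/allP=> -[[s a] t] Et; apply/allP=> -[[s' a'] t'] Et' /=.
  apply/implyP=> /eqP[es ea]; case: a' / ea Et' => Et'; case: s' / es Et' => Et'.
  have [y sy] : exists y, s = f y.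
    move: Et; rewrite mem_cat => /orP[|/mapP[[[r b] m] + [-> _ _]] /=].
      case/flattenP=> es /mapP[g _ ->]; elim: g [::] => //= c g IHg y.
      by rewrite inE => /orP[/eqP[-> _ _]|/IHg //]; exists y.
    case/flattenP=> es /mapP[g _ ->]; elim: g [::] => //= c g IHg y.
    by rewrite inE => /orP[/eqP[_ _ ->]|/IHg //]; exists (y ++ [:: c]).
  by rewrite (Ef _ _ _ Et _ sy) (Ef _ _ _ Et' _ sy).
(* The edges along [g] were put into [E], and the path closes up because [g] lies in [H]. *)
- apply/allP=> g gG; apply/acceptsP; rewrite -{1}f1.
  have -> : 0 = f ([::] ++ g) by rewrite -f1; apply/fP/same_coset1/in_subgroup_gen.
  have: {subset walk_edges f [::] g <= symm E}.
    move=> e eg; rewrite mem_cat; apply/orP; left.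
    by apply/flattenP; exists (walk_edges f [::] g); rewrite ?map_f.
  elim: g {gG} [::] => /= [y _|a g IHg y subE]; first by rewrite cats0.
  exists (f (y ++ [:: a])); first by rewrite subE ?mem_head.
  by rewrite -(cat_rcons a) -cats1; apply: IHg => e eg; apply: subE; rewrite inE eg orbT.
(* Acceptance would put the reduced form of [x] in the coset of the empty word, that is in [H]. *)
apply/negP=> /acceptsP/tracesf/(_ [::]); rewrite f1 => /(_ erefl).
by rewrite -{1}f1 => /fP; rewrite same_coset1 /= => /in_subgroup_weq; move/(_ _ (reduceK x)).
Qed.

End Schreier.

(** * Walks confined to finitely many cosets *)

Section PowerBound.
Variables (n : nat) (gens : seq (word n)).
Implicit Types (a : letter n) (x y z w u v p q g h : word n) (T : seq (word n)).

Definition prefixes z := [seq take i z | i <- iota 0 (size z).+1].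

Lemma mem_prefixes y z : y \in prefixes (y ++ z).
Proof.
apply/mapP; exists (size y); last by rewrite take_size_cat.
by rewrite mem_iota ltnS size_cat leq_addr.
Qed.

Definition covered T x := exists2 p, p \in T & same_coset gens x p.

Lemma covered_same_coset T x y : same_coset gens x y -> covered T x -> covered T y.
Proof. by move=> exy [p pT xp]; exists p; rewrite -?exy. Qed.

(** Reading [z] from the coset of [x] visits only cosets with a representative in [T]. *)
Fixpoint walk T x z :=
  covered T x /\ if z is a :: z' then walk T (x ++ [:: a]) z' else True.

Lemma walk_covered T x z : walk T x z -> covered T x.
Proof. by case: z => [|a z] []. Qed.

Lemma walk_same_coset T x y z : same_coset gens x y -> walk T x z -> walk T y z.
Proof.
elim: z x y => [|a z IHz] x y exy /= [/(covered_same_coset exy) Vy Wz]; split=> //.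
exact: IHz (same_coset_cat _ exy) Wz.
Qed.

Lemma walk_cat T x y z : walk T x (y ++ z) <-> walk T x y /\ walk T (x ++ y) z.
Proof.
elim: y x => [|a y IHy] x /=.
  by rewrite cats0; split=> [Wz|[]//]; split=> //; split=> //; apply: walk_covered Wz.
by rewrite IHy -catA; tauto.
Qed.

Lemma walk_last T x z : walk T x z -> covered T (x ++ z).
Proof. by rewrite -{1}[z]cats0 walk_cat => -[_ /walk_covered]. Qed.

Lemma walk_inv T x z : walk T x z -> walk T (x ++ z) (winv z).
Proof.
elim: z x => [|a z IHz] x /=; first by rewrite cats0.
case=> Vx /IHz; rewrite winv_cons -catA /= => Wz; apply/walk_cat; split=> //=.
have xa := walk_last Wz; split=> //; split=> //; apply: covered_same_coset Vx.
by apply: weq_same_coset; rewrite -catA -winv_cons -catA cat_winv cats0.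
Qed.

(* Free reduction only removes backtracking from a walk, so it visits no new coset. *)
Lemma walk_reduce T x z : walk T x z -> walk T x (reduce z).
Proof.
elim: z x => //= a z IHz x [Vx /IHz]; rewrite -/(reduce z).
case: (reduce z) => [|b z'] /=; first by case.
case=> Vxa Wz; case: eqP Wz => [->|_] Wz //=.
by apply: walk_same_coset Wz; apply: weq_same_coset; apply: weq_rcons_letterV.
Qed.

Lemma walk_prefixes T z : {subset prefixes z <= T} -> walk T [::] z.
Proof.
move=> subT; have: {subset prefixes ([::] ++ z) <= T} by [].
elim: z [::] {subT} => [|a z IHz] y subT /=.
  by split=> //; exists y; [apply/subT/mem_prefixes | reflexivity].
split; first by exists y; [apply/subT/mem_prefixes | reflexivity].
by apply: IHz; rewrite -catA.
Qed.

(** A product of generators and inverses is a chain of loops at the base coset, each inside [T]. The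
    word [h] itself may leave [T], hence the equivalent [h']. *)
Lemma walk_subgroup T h : walk T [::] [::] -> {in gens, forall g, walk T [::] g} ->
  in_subgroup gens h -> exists2 h', weq h h' & walk T [::] h'.
Proof.
move=> W1 Wg; apply: (@in_subgroup_ind _ gens (fun h => exists2 h', weq h h' & walk T [::] h')).
- by move=> x y exy [h' eh Wh]; exists h' => //; rewrite -exy.
- by exists [::].
- move=> g x gG [h' eh Wh]; exists (g ++ h'); first by rewrite eh.
  apply/walk_cat; split; first exact: Wg.
  by apply: walk_same_coset Wh; apply/same_coset1/in_subgroup_gen.
move=> g x gG [h' eh Wh]; exists (winv g ++ h'); first by rewrite eh.
have sg : same_coset gens [::] g by apply/same_coset1/in_subgroup_gen.
apply/walk_cat; split.
  apply: walk_same_coset (walk_inv (Wg _ gG)); symmetry; exact: sg.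
by apply: walk_same_coset Wh; apply/same_coset1/in_subgroupV/in_subgroup_gen.
Qed.

End PowerBound.

(** * A bound on the least positive power in a coset *)

Section MinimalPower.
Variables (n : nat) (gens : seq (word n)).
Implicit Types (a : letter n) (x y z w u v p q g h : word n) (T : seq (word n)).

Lemma size_prefixes z : size (prefixes z) = (size z).+1.
Proof. by rewrite size_map size_iota. Qed.

(** Counts the prefixes of the generators, of [winv v] and of [u ++ winv v], where the conjugator
    [v] of the cyclic reduction is no longer than [w]. *)
Definition power_bound u w :=
  sumn [seq (size g).+1 | g <- gens] + ((size w).+1 + (size u + size w).+1).

Lemma power_bound_spec u w k : 0 < k -> in_coset gens u (wpow w k) ->
  exists j, [/\ 0 < j, j <= power_bound u w & in_coset gens u (wpow w j)].
Proof.
have [v [c [wvc szv red_c]]] := cyclic_reduction w.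
(* In the group [w^j u^-1 = p c^j q^-1], so the question is whether [c^j] leads from the coset of
   [p] to that of [q]. *)
pose p := winv v; pose q := u ++ winv v.
have cosetE j : in_coset gens u (wpow w j) <-> same_coset gens (p ++ wpow c j) q.
  have: weq (wpow w j ++ winv u) ((p ++ wpow c j) ++ winv q).
    by rewrite wvc wpow_conj /q winv_cat winvK -!catA.
  by move=> ewq; split; apply: in_subgroup_weq => //; symmetry.
pose T := flatten (map (@prefixes n) gens) ++ (prefixes p ++ prefixes q).
have szT : size T <= power_bound u w.
  rewrite !size_cat size_flatten /shape -map_comp !size_prefixes size_cat.
  rewrite /p /winv size_rev size_map.
  by rewrite leq_add ?leq_add ?ltnS ?leq_add2l // (eq_map size_prefixes).
have Wp : walk gens T [::] p by apply: walk_prefixes => y; rewrite !mem_cat => ->; rewrite orbT.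
have Wq : walk gens T [::] q by apply: walk_prefixes => y; rewrite !mem_cat => ->; rewrite !orbT.
have Wg : {in gens, forall g, walk gens T [::] g}.
  move=> g gG; apply: walk_prefixes => y yg; rewrite mem_cat; apply/orP; left.
  by apply/flattenP; exists (prefixes g) => //; apply: map_f.
have [f [_ fP]] := coset_numbering gens.
have [m] := ubnP k; elim: m k => // m IHm k ltkm k_gt0 /cosetE Hk.
have [lekT|ltTk] := leqP k (size T).
  by exists k; split=> //; [apply: leq_trans szT | apply/cosetE].
(* For some [h] in [H], [c^k = p^-1 h q]: walk from [p] back to the base, around [h], then out to
   [q]. Reduction stays within [T], and [c^k] is already reduced. *)
have Wk : walk gens T p (wpow c k).
  have [h eh Wh] := walk_subgroup (conj (walk_covered Wp) I) Wg Hk.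
  have ech : weq (wpow c k) (winv p ++ h ++ q).
    by rewrite -eh -!catA winv_catl cats0 cat_winvKl.
  rewrite -(reduce_id (red_c k)) ech; apply/walk_reduce/walk_cat; split.
    exact: (@walk_inv _ _ _ [::]).
  apply: walk_same_coset (weq_same_coset _ (_ : weq [::] _)) _; first by rewrite cat_winv.
  apply/walk_cat; split=> //; apply: walk_same_coset Wq.
  by apply/same_coset1; apply: in_subgroup_weq eh Hk.
have cov i : i <= k -> covered gens T (p ++ wpow c i).
  by move=> leik; move: Wk; rewrite -(subnKC leik) wpowD walk_cat => -[_ /walk_covered].
(* Exponents start at 1, so that the shortened power is still positive. *)
pose s := [seq f (p ++ wpow c i) | i <- iota 1 k].
have: ~~ uniq s.
  apply/negP=> /uniq_leq_size-/(_ (map f T)); rewrite !size_map size_iota leqNgt ltTk => H.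
  apply: notF; apply: H => e /mapP[i]; rewrite mem_iota add1n ltnS => /andP[_ /cov[y yT ey]] ->.
  by apply/mapP; exists y => //; apply/fP.
case/(uniqPn 0)=> i [j []]; rewrite size_map size_iota => ltij ltjk.
have ltik := ltn_trans ltij ltjk.
rewrite !(nth_map 0) ?size_iota // !nth_iota // !add1n => /fP Hij.
have := same_coset_cat (wpow c (k - j.+1)) Hij.
rewrite -2!(catA p) -(wpowD c i.+1) -(wpowD c j.+1) (subnKC ltjk) => Hik.
(* Positions [i] and [j] carry the exponents [i.+1] and [j.+1]; the segment between them is cut
   out. *)
apply: (IHm (i.+1 + (k - j.+1))) => //.
  apply: leq_trans (_ : k <= m); last by rewrite -ltnS.
  by rewrite -{2}(subnKC ltjk) ltn_add2r ltnS.
by apply/cosetE; rewrite Hik.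
Qed.

End MinimalPower.

(** * Deciding membership and computing orders *)

Section Decision.
Variable n : nat.
Implicit Types (A : countType) (x u w : word n) (gens : seq (word n)) (c : seq (seq nat)).

(* Certificates are searched for in [seq (seq nat)], where every number is the
   code of some element, rather than among lists of labelled edges: there a
   number may be no code at all, and a machine fed with it need not halt. *)
Definition decode_edges c : seq (nat * letter n * nat) :=
  flatten [seq [seq (nth 0 e 0, a, nth 0 e 2)
               | a <- [seq a <- enum {: letter n} | pickle a == nth 0 e 1]] | e <- c].

Lemma decode_edges_surj E : exists c, decode_edges c = E.
Proof.
exists [seq [:: e.1.1; pickle e.1.2; e.2] | e <- E].
rewrite /decode_edges -map_comp (eq_map (g := fun e => [:: e])); first exact: flatten_seq1.
move=> [[s a] t] /=; rewrite (eq_filter (a2 := pred1 a)).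
  by rewrite filter_pred1_uniq ?enum_uniq // mem_enum.
by move=> b /=; rewrite (inj_eq (pcan_inj pickleK)).
Qed.

(** The [flatten] lets both kinds of certificate share one type, so that a single search covers
    both. *)
Definition generates gens x c :=
  reduce x == reduce (flatten (map (nth [::] (gens ++ map (@winv n) gens)) (flatten c))).

Definition separates gens x c :=
  [&& det (symm (decode_edges c)), all (accepts (symm (decode_edges c))) gens
    & ~~ accepts (symm (decode_edges c)) (reduce x)].

Lemma generates_in_subgroup gens x c : generates gens x c -> in_subgroup gens x.
Proof. by move/eqP=> ex; apply/in_subgroup_nth; exists (flatten c). Qed.

Lemma separates_notin_subgroup gens x c : separates gens x c -> ~ in_subgroup gens x.
Proof.
case/and3P=> detE accE /negP nacc Hx; apply: nacc.
exact: accepts_subgroup detE accE Hx.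
Qed.

(** Excluded middle enters only here, to show that the search halts; the search itself is
    effective. *)
Lemma certificate_exists gens x : exists c, generates gens x c || separates gens x c.
Proof.
have [Hx|Hx] := excluded_middle_informative (in_subgroup gens x).
  have /in_subgroup_nth[s xs] := Hx; exists [:: s]; apply/orP; left.
  by rewrite /generates /= cats0; apply/eqP.
have [E [detE accE nacc]] := nonmember_automaton Hx.
have [c ec] := decode_edges_surj E; exists c; apply/orP; right.
by rewrite /separates ec detE accE.
Qed.

Definition seqs_of_nat (m : nat) : seq (seq nat) := map CodeSeq.decode (CodeSeq.decode m).

Lemma seqs_of_natK m : pickle (seqs_of_nat m) = m.
Proof.
rewrite /seqs_of_nat /pickle /= /pickle_seq -map_comp.
rewrite (eq_map (g := id)) ?map_id ?CodeSeq.decodeK //.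
by move=> k /=; rewrite /pickle /= /pickle_seq map_id CodeSeq.decodeK.
Qed.

Lemma pickle_seqsK c : seqs_of_nat (pickle c) = c.
Proof. by apply: (pcan_inj pickleK); rewrite seqs_of_natK. Qed.

(** A number is already the code of the list it decodes to, so the same program computes both. *)
Lemma comp_seqs_of_nat A (m : A -> nat) :
  computable m -> computable (fun a => seqs_of_nat (m a)).
Proof. by case=> c Hc; exists c => a; rewrite seqs_of_natK; apply: Hc. Qed.

Ltac word_comp := repeat first [comp_step
  | apply: comp_inv_letter | apply: comp_push | apply: comp_reduce
  | apply: comp_winv | apply: comp_wpow | apply: comp_seqs_of_nat].

Lemma comp_generates : computable (fun p : seq (word n) * word n * seq (seq nat) =>
  generates p.1.1 p.1.2 p.2).
Proof. by rewrite /generates; word_comp. Qed.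

Lemma comp_accepts A (E : A -> seq (nat * letter n * nat)) (z : A -> word n) :
  computable E -> computable z -> computable (fun a => accepts (E a) (z a)).
Proof. by move=> HE Hz; rewrite /accepts /successors; word_comp. Qed.

Lemma comp_separates : computable (fun p : seq (word n) * word n * seq (seq nat) =>
  separates p.1.1 p.1.2 p.2).
Proof.
have HE A (c : A -> seq (seq nat)) :
    computable c -> computable (fun a => symm (decode_edges (c a))).
  by move=> Hc; rewrite /symm /decode_edges; word_comp.
by rewrite /separates /det; word_comp; do ?[apply: comp_accepts | apply: HE | word_comp].
Qed.

Lemma exists_certificate (p : seq (word n) * word n) : exists m,
  generates p.1 p.2 (seqs_of_nat m) || separates p.1 p.2 (seqs_of_nat m).
Proof.
by have [c Hc] := certificate_exists p.1 p.2; exists (pickle c); rewrite pickle_seqsK.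
Qed.

Definition memberb (p : seq (word n) * word n) :=
  generates p.1 p.2 (seqs_of_nat (ex_minn (exists_certificate p))).

(** If the certificate found does not generate [x], it separates [x] from the subgroup, so the
    answer is correct either way. *)
Lemma memberP p : reflect (in_subgroup p.1 p.2) (memberb p).
Proof.
rewrite /memberb; case: ex_minnP => m Hm _; apply: (iffP idP); first exact: generates_in_subgroup.
by case/orP: Hm => // /separates_notin_subgroup.
Qed.

Lemma comp_memberb : computable memberb.
Proof.
have Hg := comp_generates; have Hs := comp_separates.
pose f (q : seq (word n) * word n * nat) := (q.1, seqs_of_nat q.2).
pose mf p := (p, seqs_of_nat (ex_minn (exists_certificate p))).
apply: (comp_comp Hg (f := mf)); rewrite /mf; word_comp; apply: comp_mu; word_comp.
- by apply: (comp_comp Hg (f := f)); rewrite /f; word_comp.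
- by apply: (comp_comp Hs (f := f)); rewrite /f; word_comp.
Qed.

End Decision.

(** * Bounded search for the order *)

Section Order.
Variable n : nat.
Implicit Types (x u w : word n) (gens : seq (word n)) (t : seq (word n) * word n * word n).

Lemma pickle_pair_geq (A B : countType) (a : A) (b : B) :
  pickle a + pickle b + 2 <= pickle (a, b).
Proof. by have := sumn_code [:: pickle a; pickle b]; rewrite /= addn0. Qed.

(** Each letter contributes its own positive code and one more for the list cell. The factor 2 pays
    for the two occurrences of [size w] in [power_bound]. *)
Lemma pickle_word_geq w : 2 * size w <= pickle w.
Proof.
apply: leq_trans (sumn_code (map pickle w)); rewrite size_map.
elim: w => //= a w; have : 0 < pickle a.
  by case: a => i e; apply: leq_trans (pickle_pair_geq i e); rewrite addn2.
move: (pickle a) (sumn _) => p s; lia.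
Qed.

(** The code of the input can thus replace [power_bound] as the search limit, with nothing to
    compute. *)
Lemma power_bound_pickle gens u w : power_bound gens u w <= pickle (gens, u, w).
Proof.
have := pickle_pair_geq (gens, u) w; have := pickle_pair_geq gens u.
have := pickle_word_geq w; have := pickle_word_geq u.
suff: sumn [seq (size g).+1 | g <- gens] <= pickle gens.
  rewrite /power_bound; move: (sumn _) (size u) (size w) => s a b.
  move: (pickle (gens, u, w)) (pickle (gens, u)) (pickle gens) (pickle u) (pickle w); lia.
apply: leq_trans (sumn_code (map pickle gens)); rewrite size_map.
elim: gens => //= g gens; move: (pickle_word_geq g).
by move: (pickle g) (sumn (map pickle gens)) => p s; lia.
Qed.

(** The first disjunct stops the search just above the limit, so that a least [k] always exists. *)
Definition order_test t k :=
  (pickle t < k) || (0 < k) && memberb (t.1.1, wpow t.2 k ++ winv t.1.2).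

Lemma order_test_ex t : exists k, order_test t k.
Proof. by exists (pickle t).+1; rewrite /order_test leqnn. Qed.

Definition coset_order t :=
  if ex_minn (order_test_ex t) <= pickle t then ex_minn (order_test_ex t) else 0.

Lemma coset_orderP gens u w : is_Ord (in_coset gens u) w (coset_order (gens, u, w)).
Proof.
rewrite /coset_order; case: ex_minnP => k; rewrite {1}/order_test /= => + mink.
have test j : 0 < j -> in_coset gens u (wpow w j) -> k <= j.
  by move=> j_gt0 Hj; apply: mink; apply/orP; right; rewrite j_gt0; apply/memberP.
case: leqP => /= [_ /andP[k_gt0 /memberP Hk]|ltk _]; [right|left].
  by split=> //; split=> // j j_gt0 ltjk /(test j j_gt0); rewrite leqNgt ltjk.
(* A positive power in the coset would yield one with exponent within the limit, where the search
   would have stopped. *)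
split=> // j j_gt0 /(power_bound_spec j_gt0)[i [i_gt0 lei /(test i i_gt0)]].
by rewrite leqNgt (leq_ltn_trans _ ltk) // (leq_trans lei) ?power_bound_pickle.
Qed.

Lemma comp_coset_order : computable coset_order.
Proof.
have Hm := @comp_memberb n.
have Hk : computable (fun t => ex_minn (order_test_ex t)).
  by apply: comp_mu; rewrite /order_test; comp; [apply: comp_wpow|apply: comp_winv]; comp.
by rewrite /coset_order; comp.
Qed.

Lemma subgroup_orderP gens w : is_Ord (in_subgroup gens) w (coset_order (gens, [::], w)).
Proof.
have eS j : in_coset gens [::] (wpow w j) <-> in_subgroup gens (wpow w j).
  by rewrite /in_coset cats0.
case: (coset_orderP gens [::] w) => [[-> H]|[k_gt0 [Hk H]]]; [left|right].
  by split=> // j /H + /eS.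
split=> //; split=> [|j j_gt0 ltj]; first exact/eS.
by rewrite -eS; apply: H.
Qed.

End Order.

Lemma is_Ord_inj n (S : word n -> Prop) w j k : is_Ord S w j -> is_Ord S w k -> j = k.
Proof.
case=> [[-> Hj]|[j_gt0 [Sj minj]]] [[-> Hk]|[k_gt0 [Sk mink]]] //.
- by case: (Hj k).
- by case: (Hk j).
by case: (ltngtP j k) => // [ltjk|ltkj]; [case: (mink j)|case: (minj k)].
Qed.

Theorem theorem6p30 (n : nat) :
  (* coset order problem: input (gens of H, u, w), output Ord_{Hu}(w) *)
  (exists c : code, forall (gens : seq (word n)) (u w : word n),
      exists k, eval c [:: pickle (gens, u, w)] k /\
                is_Ord (in_coset gens u) w k) /\
  (* order problem: input (gens of H, w), output Ord_H(w) *)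
  (exists c : code, forall (gens : seq (word n)) (w : word n),
      exists k, eval c [:: pickle (gens, w)] k /\
                is_Ord (in_subgroup gens) w k) /\
  (* torsion problem: input (gens of H, w), output 1 iff Ord_H(w) <> 0, else 0 *)
  (exists c : code, forall (gens : seq (word n)) (w : word n),
      exists b : bool, eval c [:: pickle (gens, w)] b /\
        (b <-> exists k, 0 < k /\ is_Ord (in_subgroup gens) w k)).
Proof.
have Ho := @comp_coset_order n.
(* The order in [H] is the order in the coset of the empty word. *)
have Hs : computable (fun p : seq (word n) * word n => coset_order (p.1, [::], p.2)).
  by apply: (comp_comp Ho (f := fun p => (p.1, [::], p.2))); comp.
split; [|split].
- case: Ho => c Hc; exists c => gens u w; exists (coset_order (gens, u, w)).
  by split; [apply: Hc | apply: coset_orderP].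
- case: Hs => c Hc; exists c => gens w; exists (coset_order (gens, [::], w)).
  by split; [apply: (Hc (gens, w)) | apply: subgroup_orderP].
have [c Hc] := comp_leq (comp_const _ 1) Hs.
exists c => gens w; exists (0 < coset_order (gens, [::], w)); split; first exact: (Hc (gens, w)).
have Hk := subgroup_orderP gens w.
by split=> [k_gt0|[k [k_gt0 /(is_Ord_inj Hk)->]]] //; exists (coset_order (gens, [::], w)).
Qed.
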